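(* For all positive integers $n$, $k$, and $l$ with $k>l$, \[ \max_{d\mid n}\left\{\alpha(\mathbb{Z}_d,\{k,l\})\cdot\frac{n}{d}\right\} \;=\; \max_{d\mid n}\left\{\gamma(\mathbb{Z}_d,\{k,l\})\cdot\frac{n}{d}\right\}. \]
   Context: For a subset $A$ of $\mathbb{Z}_d$ and a positive integer $h$, $hA$ denotes the $h$-fold sumset $\{a_1+\cdots+a_h : a_i\in A\}$. For positive integers $k>l$, $A$ is $(k,l)$-sum-free if $kA\cap lA=\emptyset$. An arithmetic progression in $\mathbb{Z}_d$ is a set $\{a+i\cdot b : i=0,1,\dots,m-1\}$ with $m$ a positive integer, $a,b\in\mathbb{Z}_d$ and $m\le d/\gcd(d,b)$ (so it has exactly $m$ elements); when $m=1$ one takes $b=1$. $\alpha(\mathbb{Z}_d,\{k,l\})$ is the maximum size of a $(k,l)$-sum-free arithmetic progression in $\mathbb{Z}_d$, and $\gamma(\mathbb{Z}_d,\{k,l\})$ is the maximum size of a $(k,l)$-sum-free arithmetic progression in $\mathbb{Z}_d$ whose common difference $b$ satisfies $\gcd(b,d)=1$ (each taken to be $0$ if there is none). *)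

(* Defs.v *)
From mathcomp Require Import all_boot all_algebra.

Set Implicit Arguments.
Unset Strict Implicit.
Unset Printing Implicit Defensive.

Import GRing.Theory.
Local Open Scope ring_scope.

(* Z_d for d > 0, as ordinals with addition modulo d. The library's 'Z_d is
   not used because 'Z_1 is not trivial, whereas Zmod 1 = 'I_1 is. Zmod 0 is
   a junk value. *)
Definition Zmod (d : nat) : finZmodType := 'I_d.-1.+1.

(* The h-fold sumset; summands may be repeated. *)
Definition sumset (d h : nat) (A : {set Zmod d}) : {set Zmod d} :=
  [set \sum_(i < h) f i | f : {ffun 'I_h -> Zmod d} in ffun_on A].

Definition sum_free (d k l : nat) (A : {set Zmod d}) : bool :=
  sumset k A :&: sumset l A == set0.

(* A is an arithmetic progression with common difference b and m terms. The
   element b is also read as its representative in {0, ..., d - 1}, with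
   gcd(d, 0) = d. Bounding m by d loses nothing, as d %/ gcdn d b <= d. For
   m = 1 the difference is normalised to 1 (which is 0 in Z_1), so singletons
   are progressions of difference coprime to d. *)
Definition is_AP (d : nat) (b : 'I_d.-1.+1) (A : {set Zmod d}) : bool :=
  [exists m : 'I_d.+1, exists a : Zmod d,
    [&& (0 < m)%N, (m <= d %/ gcdn d b)%N, ((m : nat) == 1%N) ==> (b == inZp 1)
      & A == [set a + (b : Zmod d) *+ i | i : 'I_m]]].

Definition alpha (d k l : nat) : nat :=
  \max_(A : {set Zmod d} | [exists b, is_AP b A] && sum_free k l A) #|A|.

Definition gamma (d k l : nat) : nat :=
  \max_(A : {set Zmod d} |
          [exists b : 'I_d.-1.+1, coprime b d && is_AP b A] && sum_free k l A)
     #|A|.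

(* Main.v *)
(* Let A = {a + i b : i < m} be a (k,l)-sum-free progression in Z_d and
   g = gcd(d, b), so that m <= d / g. If g does not divide (k - l) a, then the
   singleton {a mod g} is (k,l)-sum-free in Z_g, and 1 * (n / g) >= m * (n / d).
   If g > 1 divides (k - l) a, sum-freeness means that the (k + l)(m - 1) + 1
   consecutive multiples of b from -k(m - 1) b to l(m - 1) b miss an element of
   g Z_d, so that (k + l)(m - 1) + 1 < d / g <= d / 2. Moreover d does not
   divide k - l, so gcd(k - l, d) <= d / 2, and there is room for an interval of
   length m (difference 1) in Z_d that is (k,l)-sum-free. *)

Require Import Defs.
From mathcomp Require Import all_boot all_algebra.
From mathcomp Require Import zify.

Set Implicit Arguments.
Unset Strict Implicit.
Unset Printing Implicit Defensive.

Import GRing.Theory.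

Definition prog (d m : nat) (a b : Zmod d) : {set Zmod d} :=
  [set (a + b *+ (i : nat))%R | i : 'I_m].

Lemma eq_Zmod_comb (d k l s t : nat) (a b : Zmod d) : 0 < d ->
  ((a *+ k + b *+ s)%R == (a *+ l + b *+ t)%R) =
  (a * k + b * s == a * l + b * t %[mod d]).
Proof.
case: d a b => // d a b _.
by rewrite -val_eqE !Zp_mulrn /= !modnDm.
Qed.

(** Distribute [s] as evenly as possible: each summand gets [s %/ h], and the first [s %% h] of them
    get one more. *)
Lemma balanced_summands (h m s : nat) : 0 < h -> s <= h * m ->
  exists c : 'I_h -> 'I_m.+1, \sum_(i < h) (c i : nat) = s.
Proof.
move=> h0 sm.
have bound (i : 'I_h) : s %/ h + (i < s %% h) < m.+1.
  rewrite ltnS; case: (ltnP i (s %% h)) => ir; rewrite ?addn1 ?addn0.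
    (* A summand is rounded up only if [s] differs from [h * m], and then [s %/ h < m]. *)
    by rewrite ltn_divLR // mulnC ltn_neqAle sm andbT; apply/eqP => e;
      rewrite e modnMr in ir.
  by rewrite -(mulKn m h0) leq_div2r.
exists (fun i => Ordinal (bound i)) => /=.
rewrite big_split /= sum_nat_const card_ord.
under [X in _ + X]eq_bigr do rewrite -[nat_of_bool _]/(if _ then 1 else 0).
rewrite -big_mkcond /= -(big_ord_widen h (fun=> 1)) //; last first.
  exact: ltnW (ltn_pmod s h0).
by rewrite sum1_card card_ord mulnC -divn_eq.
Qed.

(** Sums of [h] indices from 0 to [m] fill 0 to [h * m] without gaps, by [balanced_summands]. *)
Lemma sumset_prog (d h m : nat) (a b : Zmod d) (x : Zmod d) : 0 < h ->
  reflect (exists2 s, s <= h * m & x = (a *+ h + b *+ s)%R)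
          (x \in sumset h (prog m.+1 a b)).
Proof.
move=> h0; apply: (iffP imsetP) => [[f /ffun_onP fA ->]|[s sm ->]].
  have /fin_all_exists [c fc] : forall i : 'I_h, exists j : 'I_m.+1,
      f i = (a + b *+ (j : nat))%R.
    by move=> i; have /imsetP [j _ ->] := fA i; exists j.
  exists (\sum_i (c i : nat)).
    rewrite -[h in h * m]card_ord -sum_nat_const; apply: leq_sum => i _.
    by rewrite -ltnS.
  rewrite (eq_bigr _ (fun i _ => fc i)) big_split /= sumr_const card_ord.
  by rewrite -sumrMnr.
have [c cs] := balanced_summands h0 sm.
exists [ffun i => (a + b *+ (c i : nat))%R].
  by apply/ffun_onP => i; rewrite ffunE; apply/imsetP; exists (c i).
under eq_bigr do rewrite ffunE.
by rewrite big_split /= sumr_const card_ord sumrMnr cs.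
Qed.

Lemma sum_free_progP (d k l m : nat) (a b : Zmod d) :
  0 < d -> 0 < k -> 0 < l ->
  reflect (forall s t, s <= k * m -> t <= l * m ->
             a * k + b * s <> a * l + b * t %[mod d])
          (sum_free k l (prog m.+1 a b)).
Proof.
move=> d0 k0 l0; apply: (iffP eqP) => [A0 s t sm tm /eqP e|H].
  rewrite -eq_Zmod_comb // in e.
  suff : (a *+ k + b *+ s)%R \in (set0 : {set Zmod d}) by rewrite inE.
  rewrite -A0 inE; apply/andP; split; apply/sumset_prog => //.
    by exists s.
  by exists t => //; apply/eqP.
apply/setP => x; rewrite !inE; apply/negP => /andP[].
case/sumset_prog=> // s sm -> /sumset_prog [] // t tm /eqP.
by rewrite eq_Zmod_comb // => /eqP /(H _ _ sm tm).
Qed.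

Lemma leq_gamma (d k l m : nat) (a : Zmod d) : 0 < m <= d ->
  sum_free k l (prog m a (inZp 1)) -> m <= gamma d k l.
Proof.
case: d a => [|d] a; first by case: m.
move=> /andP[m0 md] sf.
(* The reduction matters for modulus 1, where [inZp 1] is 0, still coprime to 1. *)
have cop : coprime (1 %% d.+1) d.+1 by rewrite coprime_modl coprime1n.
have cm : #|prog m a (inZp 1 : Zmod d.+1)| = m.
  rewrite card_imset ?card_ord // => i j /addrI.
  rewrite !Zp_mulrn => /(congr1 val) /=.
  rewrite !modnMml !mul1n !modn_small ?(leq_trans (ltn_ord _)) //.
  exact: val_inj.
rewrite -{1}cm; apply: (@leq_bigmax_cond _ _ (fun A : {set Zmod d.+1} => #|A|)).
apply/andP; split=> //; apply/existsP; exists (inZp 1); rewrite cop /=.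
have md' : m < d.+2 by [].
apply/existsP; exists (Ordinal md'); apply/existsP; exists a => /=.
by rewrite m0 gcdnC (eqP cop) divn1 md eqxx implybT /=.
Qed.

Lemma multiple_solvable (c d v : nat) : gcdn c d %| v ->
  exists x, c * x = v %[mod d].
Proof.
case: (posnP c) => [-> | c0].
  by rewrite gcd0n => /eqP dv; exists 0; rewrite mul0n mod0n dv.
move=> /dvdnP[q ->]; case: (egcdnP d c0) => u w e _.
exists (u * q); rewrite mulnA (mulnC c) e mulnDl mulnAC.
by rewrite modnMDl mulnC.
Qed.

(* The interval of length m.+1 starting at x is sum-free iff (k - l) x avoids
   [- k m, l m] modulo d; the complement of that window is long enough to
   contain a multiple of gcdn (k - l) d. *)
Lemma leq_gamma_interval (d k l m : nat) : 0 < l -> l < k ->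
  (k + l) * m + gcdn (k - l) d < d -> m.+1 <= gamma d k l.
Proof.
move=> l0 lk bnd.
have c0 : 0 < k - l by lia.
have d0 : 0 < d := leq_ltn_trans (leq0n _) bnd.
have k0 : 0 < k by lia.
have g0 : 0 < gcdn (k - l) d by rewrite gcdn_gt0 c0.
set g := gcdn _ _ in bnd g0.
(* The least multiple of [g] above [l * m]. *)
pose v := ((l * m) %/ g).+1 * g.
have [x xv] := multiple_solvable (dvdn_mull ((l * m) %/ g).+1 (dvdnn g)).
rewrite -/v in xv.
have [v1 v2] : l * m < v /\ v <= l * m + g.
  by rewrite /v; have := divn_eq (l * m) g; have := ltn_pmod (l * m) g0; nia.
apply: (@leq_gamma d k l m.+1 (inZp x)); first by nia.
apply/sum_free_progP => // s t sm tm.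
have -> : (inZp x : 'I_d.-1.+1) = x %% d :> nat by rewrite /= prednK.
have -> : (inZp 1 : 'I_d.-1.+1) = 1 %% d :> nat by rewrite /= prednK.
rewrite -(modnDm (_ * k)) -(modnDm (_ * l)) !modnMml !modnDm !mul1n.
have -> : x * k = x * l + (k - l) * x by nia.
(* What remains is [v + s = t] modulo [d]. Both sides are below [d], so it would be an equality,
   against [t <= l * m < v]. *)
rewrite -addnA => /eqP; rewrite eqn_modDl -modnDml xv modnDml.
by rewrite !modn_small => [/eqP||]; nia.
Qed.

(** The witness [e] is [d], or [gcdn d b] when this does not divide [k - l] times the first term of
    [A]. *)
Lemma sum_free_AP_gamma (d k l : nat) (A : {set Zmod d}) (b : 'I_d.-1.+1) :
  0 < d -> 0 < l -> l < k -> is_AP b A -> sum_free k l A ->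
  exists2 e, e %| d & #|A| <= gamma e k l * (d %/ e).
Proof.
move=> d0 l0 lk AP sf.
have k0 : 0 < k by lia.
have [g1|g1] := eqVneq (gcdn d b) 1.
  exists d => //; rewrite divnn d0 muln1.
  apply: (@leq_bigmax_cond _ _ (fun A : {set Zmod d} => #|A|)).
  rewrite sf andbT; apply/existsP; exists b.
  by rewrite AP andbT /coprime gcdnC g1.
have /existsP[[m _] /existsP[a /= /and4P[m0 md _ /eqP defA]]] := AP.
case: m m0 md defA => // m _ md defA.
have cA : #|A| <= m.+1.
  by rewrite defA (leq_trans (leq_imset_card _ _)) ?card_ord.
rewrite defA in sf; move/sum_free_progP: sf => /(_ d0 k0 l0) sf.
have gd := dvdn_gcdl d b; have gb := dvdn_gcdr d b.
have g0 : 0 < gcdn d b by rewrite gcdn_gt0 d0.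
set g := gcdn d b in g1 md gd gb g0.
have [ga|ga] := boolP (g %| (k - l) * a); last first.
  exists g => //; apply: leq_trans cA (leq_trans md _).
  rewrite leq_pmull //; apply: (@leq_gamma g k l 1 (inZp a)); first by lia.
  apply/sum_free_progP => // s t.
  rewrite !muln0 !leqn0 => /eqP-> /eqP->; rewrite !muln0 !addn0 /= (prednK g0).
  rewrite !modnMml => /eqP; rewrite eqn_mod_dvd ?leq_mul2l ?(ltnW lk) ?orbT //.
  by rewrite -mulnBr mulnC (negPf ga).
exists d; rewrite ?divnn ?d0 ?muln1 //; apply: leq_trans cA _.
apply: leq_gamma_interval => //.
have ed : d = d %/ g * g by rewrite divnK.
set d1 := d %/ g in md ed.
have g2 : 1 < g by lia.
have c_lt : gcdn (k - l) d * 2 <= d.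
  have /dvdnP[q e] := dvdn_gcdr (k - l) d.
  (* At [s = t = 0], sum-freeness separates [a * k] from [a * l] modulo [d]. Hence [d] does not
     divide [k - l], and the cofactor [q] is at least 2. *)
  have := sf 0 0 (leq0n _) (leq0n _); move: e; set c := gcdn _ _.
  case: q => [|[|q]] e; last by rewrite [leqRHS]e [c * 2]mulnC leq_mul2r orbT.
    by rewrite e in d0.
  rewrite mul1n in e.
  case; rewrite !muln0 !addn0; apply/eqP.
  rewrite eqn_mod_dvd ?leq_mul2l ?(ltnW lk) ?orbT // -mulnBr dvdn_mull //.
  by rewrite {1}e dvdn_gcdl.
(* As [d = d1 * g] with [g >= 2], the window [(k + l) * m] then takes less than half of [d], and the
   gcd at most half. *)
suff : (k + l) * m + 1 < d1 by nia.
rewrite ltnNge; apply/negP => d1m.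
(* The shift by [b * (k * m)] makes the window start at 0. The shifted value is [b * j] modulo [d],
   and [j] may be reduced modulo [d1] because [d] divides [b * d1]. *)
have : gcdn b d %| (k - l) * a + b * (k * m).
  by rewrite gcdnC -/g dvdn_add // dvdn_mulr.
case/multiple_solvable => j.
have -> : b * j = b * (j %% d1) %[mod d].
  have /dvdnP[b1 eb] := gb.
  rewrite {1}(divn_eq j d1) mulnDr.
  have -> : b * (j %/ d1 * d1) = b1 * (j %/ d1) * (d1 * g).
    by rewrite eb mulnACA (mulnC g).
  by rewrite -ed modnMDl.
have d10 : 0 < d1 by rewrite divn_gt0 // dvdn_leq.
have := ltn_pmod j d10; move: (j %% d1) => {}j jd1 ej.
(* Now [j <= (k + l) * m], so [j] splits into [t <= l * m] and [j - t <= k * m]; the indices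
   [k * m - (j - t)] and [t] give a forbidden coincidence. *)
pose t := minn j (l * m); have tl : t <= l * m by rewrite geq_minr.
have jt : j - t <= k * m.
  have jkl : j <= k * m + l * m by rewrite -mulnDl -ltnS (leq_trans jd1) // -addn1.
  by rewrite leq_subLR /t; case: (leqP j (l * m)) => _; rewrite ?leq_addr 1?addnC.
have tj : t <= j by rewrite geq_minl.
apply: (sf (k * m - (j - t)) t) => //; first exact: leq_subr.
have e1 : a * k = a * l + (k - l) * a.
  by rewrite [(k - l) * a]mulnC -mulnDr subnKC // ltnW.
apply/eqP; rewrite e1 -addnA eqn_modDl -(eqn_modDr (b * (j - t))).
rewrite -addnA -!mulnDr subnK // subnKC //.
by rewrite eq_sym; apply/eqP.
Qed.

Lemma gamma_le_alpha (d k l : nat) : gamma d k l <= alpha d k l.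
Proof.
apply/bigmax_leqP => A /andP[/existsP[b /andP[_ AP]] sf].
apply: (@leq_bigmax_cond _ _ (fun A : {set Zmod d} => #|A|)).
by rewrite sf andbT; apply/existsP; exists b.
Qed.

Theorem theorem9 (n k l : nat) (hn : 0 < n) (hk : 0 < k) (hl : 0 < l)
    (hkl : l < k) :
  \max_(d <- divisors n) (alpha d k l * (n %/ d)) =
  \max_(d <- divisors n) (gamma d k l * (n %/ d)).
Proof.
apply/eqP; rewrite eqn_leq; apply/andP; split; last first.
  apply/bigmax_leqP_seq => d dn _.
  apply: leq_trans (leq_bigmax_seq _ dn isT).
  by rewrite leq_mul2r gamma_le_alpha orbT.
apply/bigmax_leqP_seq => d; rewrite -dvdn_divisors // => dn _.
have d0 := dvdn_gt0 hn dn.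
have q0 : 0 < n %/ d by rewrite divn_gt0 // dvdn_leq.
(* Moving the factor [n %/ d] to the right isolates [alpha], so that its maximum can be bounded set
   by set. *)
rewrite -leq_divRL //; apply/bigmax_leqP => A /andP[/existsP[b AP] sf].
rewrite leq_divRL //.
have [e ed] := sum_free_AP_gamma d0 hl hkl AP sf.
move/(leq_mul (leqnn (n %/ d))); rewrite mulnC => /leq_trans; apply.
have en := dvdn_trans ed dn.
have -> : n %/ d * (gamma e k l * (d %/ e)) = gamma e k l * (n %/ e).
  by rewrite mulnCA muln_divA // divnK.
by apply: (@leq_bigmax_seq _ _ _ (fun e => gamma e k l * (n %/ e))); rewrite -?dvdn_divisors.
Qed.
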